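(* Let $S$ be an integral domain which is not a field, let $F$ be its field of fractions, and let $A \neq F$ be a commutative $F$-algebra having an $S$-stable basis over $F$. Let $\mathcal C$ be any chain of prime ideals of $S$. Then there exists an $S$-nice subalgebra $R$ of $A$ having a chain $\mathcal D$ of prime ideals of $R$ that covers $\mathcal C$.
   Context: Algebras are associative, unital and nonzero, and $A$ may be infinite dimensional over $F$; $F$ is identified with $F\cdot 1_A \subseteq A$. A basis $B$ of $A$ over $F$ is called $S$-stable if there exists a basis $C$ of $A$ over $F$ such that for all $c \in C$ and $b \in B$ one has $cb \in \sum_{y \in B} Sy$. An $S$-subalgebra $R$ of $A$ is called an $S$-nice subalgebra of $A$ if $R \cap F = S$ and $RF = A$, where $RF$ is the $F$-subspace of $A$ spanned by $R$. A chain of prime ideals is a set of prime ideals totally ordered by inclusion (of arbitrary cardinality). A chain $\mathcal D$ of prime ideals of $R$ covers the chain $\mathcal C$ of prime ideals of $S$ if for every $P\in\mathcal C$ there exists $Q\in\mathcal D$ lying over $P$, i.e. with $Q\cap S=P$. *)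

(* Defs.v *)
From mathcomp Require Import all_boot all_order all_algebra.
From mathcomp Require Import boolp classical_sets.

Set Implicit Arguments.
Unset Strict Implicit.
Unset Printing Implicit Defensive.

Import GRing.Theory.
Local Open Scope classical_set_scope.
Local Open Scope ring_scope.

Section LinearCombinations.
Variables (K : fieldType) (V : lmodType K).

(* All linear combinations of elements of [B] with coefficients in [L]; the
   length [n] varies and repeated vectors are harmless, so for [L] a subring
   of [K] this is the [L]-submodule generated by [B]. *)
Definition combinations (L : set K) (B : set V) : set V :=
  [set v | exists (n : nat) (c : 'I_n -> K) (b : 'I_n -> V),
    [/\ forall i, L (c i), forall i, B (b i) & v = \sum_(i < n) c i *: b i]].

Definition lin_indep (B : set V) : Prop :=
  forall (n : nat) (b : 'I_n -> V), injective b -> (forall i, B (b i)) ->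
  forall c : 'I_n -> K, \sum_(i < n) c i *: b i = 0 -> forall i, c i = 0.

Definition is_basis (B : set V) : Prop :=
  lin_indep B /\ combinations [set: K] B = [set: V].

End LinearCombinations.

Section PrimeIdeals.
Variable T : comNzRingType.

(* Ideals of the subring [R] of [T] are represented as subsets of [T]; closure
   under opposites follows from [absorb], since -1 belongs to [R]. *)
Record is_ideal (R I : set T) : Prop := IsIdeal {
  ideal_sub : I `<=` R;
  ideal_zero : I 0;
  ideal_add : forall x y, I x -> I y -> I (x + y);
  ideal_absorb : forall a x, R a -> I x -> I (a * x) }.

Record is_prime_ideal (R P : set T) : Prop := IsPrimeIdeal {
  prime_ideal_ideal : is_ideal R P;
  prime_ideal_proper : P <> R;
  prime_ideal_prime :
    forall x y, R x -> R y -> P (x * y) -> P x \/ P y }.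

Definition prime_chain (R : set T) (C : set (set T)) : Prop :=
  (forall P, C P -> is_prime_ideal R P) /\ total_on C subset.

End PrimeIdeals.

Section NiceSubalgebras.
Variables (S : idomainType) (A : comAlgType {fraction S}).

(* The embedding of [S] into [A] through its field of fractions. *)
Definition embS (s : S) : A := (tofrac s)%:A.

Definition stable_basis (B : set A) : Prop :=
  is_basis B /\
  exists C : set A, is_basis C /\
    forall c b, C c -> B b -> combinations (range (@tofrac S)) B (c * b).

Definition is_subalgebra (R : set A) : Prop :=
  subring_closed [in R] /\ forall s x, R x -> R (tofrac s *: x).

Definition nice_subalgebra (R : set A) : Prop :=
  [/\ is_subalgebra R,
      R `&` range (fun f : {fraction S} => f%:A : A) = range embS &
      combinations [set: {fraction S}] R = [set: A]].

Definition covers (D : set (set A)) (C : set (set S)) : Prop :=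
  forall P, C P -> exists Q, D Q /\ embS @^-1` Q = P.

End NiceSubalgebras.

(* Main.v *)
Require Import Defs.
From mathcomp Require Import all_boot all_order all_algebra.
From mathcomp Require Import boolp classical_sets filter.

Set Implicit Arguments.
Unset Strict Implicit.
Unset Printing Implicit Defensive.

Import GRing.Theory.
Local Open Scope classical_set_scope.
Local Open Scope ring_scope.

(** Let N be the S-span of the S-stable basis B and R = {a | aN <= N}. Then R
  contains the basis C that witnesses stability, so RF = A, and R meets F in S
  because N is free. For a prime P of S put I_P = {a in R | aN <= PN}. Since
  N / PN is free over S / P, the ideal I_P lies over P, and ta in I_P with
  t in S \ P forces a in I_P; moreover I_P increases with P. Hence below a
  prime Q' of R containing I_P' there is, for every P <= P', a prime Q
  containing I_P and lying over P: no product tw with t in S \ P and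
  w in R \ Q' lies in I_P. So finite chains lift, from the top downwards, and
  an ultrafilter argument takes care of arbitrary chains. *)

(** * Prime ideals avoiding multiplicative sets *)

Section PrimeIdeals.
Context {T : comNzRingType} {R : set T} (subringR : subring_closed [in R]).

Let R1 : R 1. Proof. by case: subringR => /set_mem. Qed.

Let RB x y : R x -> R y -> R (x - y).
Proof. by case: subringR => _ RB _ /mem_set Rx /mem_set Ry; apply/set_mem/RB. Qed.

Let RM x y : R x -> R y -> R (x * y).
Proof. by case: subringR => _ _ RM /mem_set Rx /mem_set Ry; apply/set_mem/RM. Qed.

Let R0 : R 0. Proof. by rewrite -(subrr 1); exact: RB. Qed.

Let RD x y : R x -> R y -> R (x + y).
Proof.
by move=> Rx Ry; rewrite -[y]opprK -[- y]sub0r; apply: RB => //; exact: RB.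
Qed.

Lemma is_ideal_addM (I : set T) (x : T) : is_ideal R I -> R x ->
  is_ideal R [set q + a * x | q in I & a in R].
Proof.
move=> idI Rx; split.
- by move=> _ [q Iq] [a Ra] <-; apply: RD; [exact: (ideal_sub idI) | exact: RM].
- exists 0; first exact: ideal_zero idI.
  by exists 0; rewrite ?mul0r ?addr0.
- move=> _ _ [q Iq] [a Ra] <- [p Ip] [b Rb] <-; exists (q + p); first exact: (ideal_add idI).
  by exists (a + b); [exact: RD | rewrite mulrDl addrACA].
- move=> b _ Rb [q Iq] [a Ra] <-; exists (b * q); first exact: (ideal_absorb idI).
  by exists (b * a); [exact: RM | rewrite mulrDr mulrA].
Qed.

(** Krull's argument: an ideal of [R] maximal among those that contain [I] and miss the
    multiplicative set [W] is prime. *)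
Lemma exists_prime_ideal_avoiding (I W : set T) :
    is_ideal R I -> W `<=` R -> W 1 ->
    (forall x y, W x -> W y -> W (x * y)) -> (forall x, I x -> ~ W x) ->
  exists Q, [/\ is_prime_ideal R Q, I `<=` Q & forall x, Q x -> ~ W x].
Proof.
move=> idI WR W1 WM IW.
pose good X := [/\ is_ideal R X, I `<=` X & forall x, X x -> ~ W x].
(* The empty set is admitted only because [Zorn_bigcup] ranges over the empty chain too. *)
have [F FP Ftot|Q [QP Qmax]] := @Zorn_bigcup T [set X | X = set0 \/ good X].
  have [[X FX /eqP/set0P[x0 Xx0]]|noX] := pselect (exists2 X, F X & X <> set0); last first.
    left; apply/seteqP; split=> // x [X FX Xx]; case: noX; exists X => //.
    by move=> X0; rewrite X0 in Xx.
  have goodF Y y : F Y -> Y y -> good Y by move=> /FP[->|].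
  have [idX IX _] := goodF _ _ FX Xx0.
  right; split; first split.
  - by move=> x [Y FY Yx]; have [idY _ _] := goodF _ _ FY Yx; exact: (ideal_sub idY).
  - by exists X => //; exact: ideal_zero idX.
  - move=> x y [Y FY Yx] [Z FZ Zy].
    have [YZ|ZY] := Ftot _ _ FY FZ.
      have [idZ _ _] := goodF _ _ FZ Zy.
      by exists Z => //; apply: (ideal_add idZ) => //; exact: YZ.
    have [idY _ _] := goodF _ _ FY Yx.
    by exists Y => //; apply: (ideal_add idY) => //; exact: ZY.
  - move=> a x Ra [Y FY Yx]; have [idY _ _] := goodF _ _ FY Yx.
    by exists Y => //; exact: (ideal_absorb idY).
  - by move=> x Ix; exists X => //; exact: IX.
  - by move=> x [Y FY Yx]; have [_ _] := goodF _ _ FY Yx; exact.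
have {QP} [Q0|[idQ IQ QW]] := QP.
  (* The empty set is not maximal: [I] contains 0 and is itself a candidate. *)
  case: (Qmax I); last by right; split.
  by rewrite Q0; split => // /(_ 0); apply; exact: ideal_zero idI.
exists Q; split=> //; split=> //; first by move=> QR; apply: (QW 1) => //; rewrite QR.
move=> x y Rx Ry Qxy.
(* By maximality, the ideal [Q + R z] generated by [Q] and an element [z] outside it must meet
   [W]. *)
have meetsW z : R z -> ~ Q z -> exists q a, [/\ Q q, R a & W (q + a * z)].
  move=> Rz nQz; apply: contrapT => nW.
  have QJ : Q `<=` [set q + a * z | q in Q & a in R].
    by move=> q Qq; exists q => //; exists 0; rewrite ?mul0r ?addr0.
  apply: (Qmax [set q + a * z | q in Q & a in R]).
    split=> // /(_ z) JQ; apply/nQz/JQ.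
    by exists 0; [exact: ideal_zero idQ | exists 1; rewrite ?mul1r ?add0r].
  right; split; [exact: is_ideal_addM | exact: subset_trans IQ QJ |].
  by move=> _ [q Qq] [a Ra] <- Ww; apply: nW; exists q, a.
(* The product of the elements [q + a * x] and [p + b * y] of [W] lies in [W], but also in [Q],
   since [x * y] does. *)
apply: contrapT => /not_orP[/(meetsW _ Rx)[q [a [Qq Ra Wx]]] /(meetsW _ Ry)[p [b [Qp Rb Wy]]]].
apply: (QW _ _ (WM _ _ Wx Wy)).
rewrite mulrDl; apply: (ideal_add idQ); first by rewrite mulrC; apply: (ideal_absorb idQ) => //; exact: WR.
rewrite mulrDr; apply: (ideal_add idQ); first by apply: (ideal_absorb idQ) => //; exact: RM.
by rewrite mulrACA; apply: (ideal_absorb idQ) => //; exact: RM.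
Qed.

(** * Lifting primes and chains of primes *)

Context {S : comNzRingType} (f : {rmorphism S -> T}) (fR : forall s, R (f s)).

(** Besides lying over [P], the ideal [I] is such that [R / I] is torsion-free over [S / P]. *)
Definition saturated_over (P : set S) (I : set T) : Prop :=
  [/\ is_ideal R I, f @^-1` I = P &
      forall t x, ~ P t -> R x -> I (f t * x) -> I x].

(** The products [f t * w] with [t] outside [P] and [w] in [W] form a multiplicative set, which
    misses [I] by saturation. A prime avoiding it contracts into [P] because 1 is in [W], and misses
    [W] because 1 is not in [P]. *)
Lemma exists_prime_over_avoiding (P : set S) (I W : set T) :
    is_prime_ideal [set: S] P -> saturated_over P I -> W `<=` R -> W 1 ->
    (forall x y, W x -> W y -> W (x * y)) -> (forall x, I x -> ~ W x) ->
  exists Q, [/\ is_prime_ideal R Q, f @^-1` Q = P, I `<=` Q & forall x, Q x -> ~ W x].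
Proof.
move=> primeP [idI fI satI] WR W1 WM IW.
have nP1 : ~ P 1.
  move=> P1; apply: (prime_ideal_proper primeP); apply/seteqP; split=> // s _.
  by rewrite -[s]mulr1; apply: ideal_absorb P1; [exact: prime_ideal_ideal primeP | ].
have [|||||Q [primeQ IQ QW]] := @exists_prime_ideal_avoiding I [set f t * w | t in ~` P & w in W].
- by [].
- by move=> _ [t _] [w Ww] <-; apply: RM => //; exact: WR.
- by exists 1 => //; exists 1; rewrite // rmorph1 mul1r.
- move=> _ _ [t nPt] [w Ww] <- [u nPu] [v Wv] <-; exists (t * u).
    by move=> /(prime_ideal_prime primeP)[].
  by exists (w * v); [exact: WM | rewrite rmorphM mulrACA].
- by move=> x Ix [t nPt] [w Ww] E; apply: (IW w) => //; apply: satI nPt (WR _ Ww) _; rewrite E.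
exists Q; split=> //.
- apply/seteqP; split=> s /=; last by rewrite -{1}fI; exact: IQ.
  move=> Qs; apply: contrapT => nPs; apply: QW Qs _.
  by exists s => //; exists 1; rewrite ?mulr1.
- by move=> x Qx Wx; apply: QW Qx _; exists 1 => //; exists x => //; rewrite rmorph1 mul1r.
Qed.

(* The primes are found from the top of the chain downwards: what remains is to
   avoid the complement of the smallest prime chosen so far. *)
Lemma lift_prime_seq (I : set S -> set T) (s : seq (set S)) :
    (forall P, P \in s -> is_prime_ideal [set: S] P /\ saturated_over P (I P)) ->
    {in s &, forall P P', P `<=` P' -> I P `<=` I P'} ->
    pairwise (fun P P' => `[< P `<=` P' >]) s ->
  exists Q : set S -> set T,
    (forall P, P \in s -> [/\ is_prime_ideal R (Q P), f @^-1` Q P = P & I P `<=` Q P]) /\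
    {in s &, forall P P', P `<=` P' -> Q P `<=` Q P'}.
Proof.
elim: s => [|P0 s IHs] primeI I_mono; first by exists (fun=> R).
rewrite pairwise_cons => /andP[/allP P0min s_sorted].
have {}P0min P : P \in s -> P0 `<=` P by move=> /P0min /asboolP.
have [||//|Q [primeQ Q_mono]] := IHs.
- by move=> P sP; apply: primeI; rewrite inE sP orbT.
- by move=> P P' sP sP'; apply: I_mono; rewrite inE (sP, sP') orbT.
have s_total P P' : P \in s -> P' \in s -> P `<=` P' \/ P' `<=` P.
  elim: s s_sorted {IHs primeI I_mono P0min primeQ Q_mono} => //= a s IHs /andP[/allP amin s_sorted].
  rewrite !inE => /predU1P[->|sP] /predU1P[->|sP']; [by left| | |exact: IHs].
  - by left; apply/asboolP/amin.
  - by right; apply/asboolP/amin.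
have [primeP0 satP0] := primeI P0 (mem_head _ _).
have nI1 : ~ I P0 1.
  case: satP0 => idI fI _ I1; apply: (prime_ideal_proper primeP0).
  apply/seteqP; split=> // t _; rewrite -fI /= -[f t]mulr1.
  exact: (ideal_absorb idI).
(* The complements of the chosen primes are nested, so their union is multiplicative; 1 is added for
   the case of an empty [s]. *)
pose W := [set x | x = 1 \/ exists P, [/\ P \in s, R x & ~ Q P x]].
have [||||Q0 [primeQ0 fQ0 IQ0 Q0W]] := exists_prime_over_avoiding primeP0 satP0 (W := W).
- by move=> x [->//|[P []]].
- by left.
- move=> x y [->|[P [sP Rx nQx]]]; first by rewrite mul1r.
  case=> [->|[P' [sP' Ry nQy]]]; first by rewrite mulr1; right; exists P.
  right; have [PP'|P'P] := s_total _ _ sP sP'.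
    exists P; split=> //; first exact: RM.
    have [prQ _ _] := primeQ _ sP.
    by case/(prime_ideal_prime prQ) => // /(Q_mono _ _ sP sP' PP').
  exists P'; split=> //; first exact: RM.
  have [prQ _ _] := primeQ _ sP'.
  by case/(prime_ideal_prime prQ) => // /(Q_mono _ _ sP' sP P'P).
- move=> x Ix [x1|[P [sP Rx]]]; first by apply: nI1; rewrite -x1.
  apply; have [_ _] := primeQ _ sP; apply.
  by apply: I_mono Ix; rewrite ?mem_head ?inE ?sP ?orbT //; exact: P0min.
exists (fun P => if P == P0 then Q0 else Q P); split.
  by move=> P; rewrite inE; have [->|_ /= /primeQ] := eqVneq.
move=> P P'; rewrite !inE.
have [->|PP0 /= sP] := eqVneq P P0; have [->|P'P0 /= sP'] := eqVneq P' P0 => //.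
- by move=> _ _ _.
(* An element of [Q0] outside [Q P'] would belong to [W]. *)
- move=> {}sP' _ x Q0x; apply: contrapT => nQx; apply: (Q0W _ Q0x); right.
  by exists P'; split=> //; exact: (ideal_sub (prime_ideal_ideal primeQ0)).
(* As [P0] is the least of these primes, [P] inside [P0] would give [P = P0]. *)
- by move=> _ PP; case/eqP: PP0; apply/seteqP; split=> //; exact: P0min.
- exact: Q_mono.
Qed.

(* The lifts along the finite subsets of [C] are glued along an ultrafilter. *)
Lemma lift_prime_chain (C : set (set S)) (I : set S -> set T) :
    prime_chain [set: S] C ->
    (forall P, C P -> saturated_over P (I P)) ->
    (forall P P', C P -> C P' -> P `<=` P' -> I P `<=` I P') ->
  exists D, prime_chain R D /\ forall P, C P -> exists Q, D Q /\ f @^-1` Q = P.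
Proof.
move=> [primeC totC] satI I_mono.
(* A sigma type, so that one lift is selected for every finite list. Lists may contain sets outside
   [C], which are filtered away before sorting. *)
have liftC (s : seq (set S)) : {Q : set S -> set T |
    (forall P, P \in s -> C P -> is_prime_ideal R (Q P) /\ f @^-1` Q P = P) /\
    (forall P P', P \in s -> P' \in s -> C P -> C P' -> P `<=` P' -> Q P `<=` Q P')}.
  apply/cid; pose le (P P' : set S) := `[< P `<=` P' >].
  pose sC := sort le [seq P <- s | `[< C P >]].
  have mem_sC P : (P \in sC) = `[< C P >] && (P \in s) by rewrite mem_sort mem_filter.
  have [|||Q [primeQ Q_mono]] := @lift_prime_seq I sC.
  - by move=> P; rewrite mem_sC => /andP[/asboolP CP _]; split; [exact: primeC | exact: satI].
  - by move=> P P'; rewrite !mem_sC => /andP[/asboolP CP _] /andP[/asboolP CP' _]; exact: I_mono.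
  - rewrite -sorted_pairwise; last first.
      by move=> X Y Z /asboolP YX /asboolP XZ; apply/asboolP; exact: subset_trans XZ.
    (* Inclusion is known to be total only on members of [C], hence the relative form of sorting. *)
    apply: (@sort_sorted_in _ [pred P | `[< C P >]]); last by rewrite filter_all.
    move=> P P' /asboolP CP /asboolP CP'; apply/orP.
    by have [?|?] := totC _ _ CP CP'; [left|right]; apply/asboolP.
  exists Q; split=> [P sP CP|P P' sP sP' CP CP'].
    by have [|//] := primeQ P; rewrite mem_sC sP andbT; apply/asboolP.
  by apply: Q_mono; rewrite mem_sC ?sP ?sP' andbT; apply/asboolP.
pose Q s := projT1 (liftC s).
have QP s P : P \in s -> C P -> is_prime_ideal R (Q s P) /\ f @^-1` Q s P = P.
  by rewrite /Q; case: (liftC s) => /= ? [+ _]; exact.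
have Q_mono s P P' : P \in s -> P' \in s -> C P -> C P' -> P `<=` P' -> Q s P `<=` Q s P'.
  by rewrite /Q; case: (liftC s) => /= ? [_ +]; exact.
(* The sets of all lists containing a given list generate a proper filter; for an ultrafilter [U]
   refining it, almost every list contains any given [P]. *)
pose above (s : seq (set S)) := [set s' : seq (set S) | {subset s <= s'}].
have above_filter : ProperFilter (filter_from setT above).
  apply: filter_from_proper; last by move=> s _; exists s => /= x.
  apply: filter_from_filter; first by exists [::].
  move=> s s' _ _; exists (s ++ s') => // t st.
  by split=> P Ps; apply: st; rewrite mem_cat Ps ?orbT.
have [U [ultraU aboveU]] := ultraFilterLemma above_filter.
have properU : ProperFilter U by exact: ultra_proper.
have UP P : U [set s | P \in s].
  by apply: aboveU; exists [:: P] => // s; apply; rewrite mem_head.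
(* The ultralimit of the primes [Q s P]: elements belonging to [Q s P] for [U]-almost all [s]. *)
pose lim P := [set x | U [set s | Q s P x]].
have limP P : C P -> is_prime_ideal R (lim P) /\ f @^-1` lim P = P.
  move=> CP.
  have idQ s : P \in s -> is_ideal R (Q s P).
    by move=> sP; have [/prime_ideal_ideal] := QP _ _ sP CP.
  split; first split; first split.
  - move=> x Ux; have [s [Qx sP]] := filter_ex (filterI Ux (UP P)).
    exact: (ideal_sub (idQ _ sP)).
  - by apply: filterS (UP P) => s sP; exact: ideal_zero (idQ _ sP).
  - move=> x y Ux Uy; apply: filterS (filterI (UP P) (filterI Ux Uy)) => s [sP [Qx Qy]].
    exact: (ideal_add (idQ _ sP)).
  - move=> a x Ra Ux; apply: filterS (filterI (UP P) Ux) => s [sP Qx].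
    exact: (ideal_absorb (idQ _ sP)).
  - move=> limR; have U1 : lim P 1 by rewrite limR.
    have [s [Q1 sP]] := filter_ex (filterI U1 (UP P)).
    have [primeQ _] := QP _ _ sP CP; apply: (prime_ideal_proper primeQ).
    apply/seteqP; split=> [x|x Rx]; first exact: (ideal_sub (idQ _ sP)).
    by rewrite -[x]mulr1; exact: (ideal_absorb (idQ _ sP)).
  (* Primality needs an ultrafilter: if [x] is not in [Q s P] for almost all [s], then it is outside
     for almost all [s], and there [y] must be inside. *)
  - move=> x y Rx Ry Uxy; have [|Ux] := in_ultra_setVsetC [set s | Q s P x] ultraU; first by left.
    right; apply: filterS (filterI (UP P) (filterI Ux Uxy)) => s [sP [nQx Qxy]].
    have [primeQ _] := QP _ _ sP CP.
    by case: (prime_ideal_prime primeQ Rx Ry Qxy).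
  - apply/seteqP; split=> t /=.
      move=> Ut; have [s [Qt sP]] := filter_ex (filterI Ut (UP P)).
      by have [_ <-] := QP _ _ sP CP.
    by move=> Pt; apply: filterS (UP P) => s sP; have [_ fQ] := QP _ _ sP CP; rewrite -fQ in Pt.
exists (lim @` C); split; last first.
  by move=> P CP; exists (lim P); have [_] := limP _ CP; split=> //; exists P.
split=> [_ [P CP <-]|]; first by have [] := limP _ CP.
have lim_mono P P' : C P -> C P' -> P `<=` P' -> lim P `<=` lim P'.
  move=> CP CP' PP' x Ux; apply: filterS (filterI Ux (filterI (UP P) (UP P'))) => s [Qx [sP sP']].
  exact: Q_mono Qx.
move=> _ _ [P CP <-] [P' CP' <-].
by have [PP'|P'P] := totC _ _ CP CP'; [left|right]; exact: lim_mono.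
Qed.

End PrimeIdeals.

(** * Coefficients of linear combinations *)

Section Combinations.
Context {K : fieldType} {V : lmodType K}.
Implicit Types (L : set K) (B : set V).

Lemma combinations0 L B : combinations L B 0.
Proof. by exists 0, (fun=> 0), (fun=> 0); split=> [[]|[]|] //; rewrite big_ord0. Qed.

Lemma combinations_gen L B b : L 1 -> B b -> combinations L B b.
Proof. by move=> L1 Bb; exists 1, (fun=> 1), (fun=> b); split=> //; rewrite big_ord1 scale1r. Qed.

Lemma combinationsD L B u v :
  combinations L B u -> combinations L B v -> combinations L B (u + v).
Proof.
move=> [n [c [b [Lc Bb ->]]]] [m [d [e [Ld Be ->]]]].
exists (n + m)%N, (fun i => match split i with inl j => c j | inr j => d j end),
  (fun i => match split i with inl j => b j | inr j => e j end); split.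
- by move=> i; case: split.
- by move=> i; case: split.
rewrite big_split_ord /=; congr (_ + _); apply: eq_bigr => i _.
  by rewrite (unsplitK (inl _ i)).
by rewrite (unsplitK (inr _ i)).
Qed.

Lemma combinationsZ L L' B k v : (forall l, L l -> L' (k * l)) ->
  combinations L B v -> combinations L' B (k *: v).
Proof.
move=> LL' [n [c [b [Lc Bb ->]]]]; exists n, (fun i => k * c i), b; split=> // [i|].
  exact: LL'.
by rewrite scaler_sumr; apply: eq_bigr => i _; rewrite scalerA.
Qed.

Lemma combinations_sum L B n (v : 'I_n -> V) :
  (forall i, combinations L B (v i)) -> combinations L B (\sum_i v i).
Proof.
by move=> Lv; elim/big_ind: _ => //; [exact: combinations0 | exact: combinationsD].
Qed.

Lemma combinations_subset L L' B B' : L `<=` L' -> B `<=` B' ->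
  combinations L B `<=` combinations L' B'.
Proof.
move=> LL' BB' _ [n [c [b [Lc Bb ->]]]]; exists n, c, b; split=> // i; [exact: LL' | exact: BB'].
Qed.

(* [c] is a total function vanishing off [s], so that it does not depend on [s]. *)
Lemma combinations_coef L B v : L 0 -> (forall k l, L k -> L l -> L (k + l)) ->
    combinations L B v ->
  exists c s, [/\ uniq s, forall y, y \in s -> B y, forall y, L (c y),
    forall y, y \notin s -> c y = 0 & v = \sum_(y <- s) c y *: y].
Proof.
move=> L0 LD [n [c [b [Lc Bb ->]]]].
(* The coefficient of [y] collects all indices at which the vector [y] occurs. *)
exists (fun y => \sum_(i | b i == y) c i), (undup (codom b)); split.
- exact: undup_uniq.
- by move=> y; rewrite mem_undup => /codomP[i ->].
- by move=> y; elim/big_ind: _.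
- move=> y; rewrite mem_undup => yb; rewrite big1 // => i /eqP biy.
  by rewrite -biy codom_f in yb.
under [RHS]eq_bigr do rewrite scaler_suml.
rewrite (exchange_big_dep predT) //=; apply: eq_bigr => i _.
have bi : b i \in undup (codom b) by rewrite mem_undup codom_f.
(* After the exchange of sums, index [i] contributes only at [y = b i]. *)
rewrite -big_filter.
have -> : [seq y <- undup (codom b) | b i == y] = [:: b i].
  under eq_filter do rewrite eq_sym.
  by rewrite filter_pred1_uniq // undup_uniq.
by rewrite big_seq1.
Qed.

(** On the union of the two supports, [c - d] gives a vanishing combination of distinct vectors of
    [B]; elsewhere both functions are 0. *)
Lemma lin_indep_coef_inj B (c d : V -> K) (s t : seq V) : lin_indep B ->
    uniq s -> (forall y, y \in s -> B y) -> (forall y, y \notin s -> c y = 0) ->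
    uniq t -> (forall y, y \in t -> B y) -> (forall y, y \notin t -> d y = 0) ->
  \sum_(y <- s) c y *: y = \sum_(y <- t) d y *: y -> c = d.
Proof.
move=> indB us sB c0 ut tB d0 Esum; pose r := undup (s ++ t).
have extend (e : V -> K) (q : seq V) : uniq q -> {subset q <= r} ->
    (forall y, y \notin q -> e y = 0) ->
  \sum_(y <- q) e y *: y = \sum_(y <- r) e y *: y.
  move=> uq qr e0; rewrite [RHS](bigID (mem q)) /= [X in _ + X]big1 ?addr0; last first.
    by move=> y /e0->; rewrite scale0r.
  rewrite -[RHS]big_filter; apply: perm_big; apply: uniq_perm => //.
    exact/filter_uniq/undup_uniq.
  by move=> y; rewrite mem_filter; case yq: (y \in q) => //=; rewrite qr.
have sr : {subset s <= r} by move=> y ys; rewrite mem_undup mem_cat ys.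
have tr : {subset t <= r} by move=> y yt; rewrite mem_undup mem_cat yt orbT.
apply/funext => y; have [yr|yr] := boolP (y \in r); last first.
  by rewrite c0 ?d0 //; apply: contraNN yr; [exact: tr | exact: sr].
have rB z : z \in r -> B z by rewrite mem_undup mem_cat => /orP[/sB|/tB].
have rn (i : 'I_(size r)) : r`_i \in r by exact: mem_nth.
have inj_r : injective (fun i : 'I_(size r) => r`_i).
  by move=> i j /eqP; rewrite nth_uniq ?undup_uniq // => /eqP/val_inj.
have sum0 : \sum_(i < size r) (c r`_i - d r`_i) *: r`_i = 0.
  under eq_bigr do rewrite scalerBl.
  rewrite sumrB; apply/eqP; rewrite subr_eq0; apply/eqP.
  have ord_sum (e : V -> K) : \sum_(i < size r) e r`_i *: r`_i = \sum_(z <- r) e z *: z.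
    by rewrite [RHS](big_nth 0) big_mkord.
  by rewrite !ord_sum -(extend c s) // -(extend d t).
have := indB _ _ inj_r (fun i => rB _ (rn i)) _ sum0 (Ordinal (etrans (index_mem y r) yr)).
by rewrite /= nth_index // => /eqP; rewrite subr_eq0 => /eqP.
Qed.

(* With [L'] an ideal of [L], membership of [k *: v] in the [L']-span of [B] can
   be tested coefficientwise. *)
Lemma combinations_saturated L L' B k v : lin_indep B ->
    L 0 -> (forall x y, L x -> L y -> L (x + y)) ->
    L' 0 -> (forall x y, L' x -> L' y -> L' (x + y)) ->
    (forall x, L x -> L' (k * x) -> L' x) ->
  combinations L B v -> combinations L' B (k *: v) -> combinations L' B v.
Proof.
move=> indB L0 LD L'0 L'D L'k.
move=> /(combinations_coef L0 LD)[c [s [us sB Lc c0 Ev]]].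
move=> /(combinations_coef L'0 L'D)[d [t [ut tB L'd d0 Ekv]]].
(* By uniqueness, the coefficients of [k *: v] are [k] times those of [v]. *)
have kcd : (fun y => k * c y) = d.
  apply: (lin_indep_coef_inj indB us sB _ ut tB d0) => [y /c0->|]; first by rewrite mulr0.
  by rewrite -Ekv Ev scaler_sumr; apply: eq_bigr => y _; rewrite scalerA.
rewrite Ev (big_nth 0) big_mkord; exists (size s), (fun i => c s`_i), (fun i => s`_i); split=> // i.
  by apply: L'k => //; have := L'd s`_i; rewrite -kcd.
by apply: sB; rewrite mem_nth.
Qed.

Lemma combinations_basis_coef L B k b : lin_indep B -> B b ->
    L 0 -> (forall x y, L x -> L y -> L (x + y)) ->
  combinations L B (k *: b) -> L k.
Proof.
move=> indB Bb L0 LD /(combinations_coef L0 LD)[d [t [ut tB Ld d0 Ekb]]].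
suff E : (fun y => if y == b then k else 0) = d by have := Ld b; rewrite -E eqxx.
have sub (z : V) : z \in [:: b] -> B z by rewrite inE => /eqP->.
apply: (@lin_indep_coef_inj B _ _ [:: b] t) => // [y|]; first by rewrite inE => /negPf->.
by rewrite big_seq1 eqxx -Ekb.
Qed.

Lemma basis_nonempty B : is_basis B -> (exists v : V, v <> 0) -> exists b, B b.
Proof.
move=> [_ spanB] [v v0].
have : combinations [set: K] B v by rewrite spanB.
move=> [[|n] [c [b [_ Bb Ev]]]]; last by exists (b ord0).
by case: v0; rewrite Ev big_ord0.
Qed.

End Combinations.

(** * The multiplier ring of the lattice spanned by a stable basis *)

Section Stabilizer.
Context {S : idomainType} {A : comAlgType {fraction S}} {B : set A}.
Hypothesis stableB : stable_basis B.

Let basisB : is_basis B. Proof. by case: stableB. Qed.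
Let indB : lin_indep B. Proof. by case: basisB. Qed.

Let tofracI : injective (@tofrac S).
Proof. by move=> x y /eqP; rewrite tofrac_eq => /eqP. Qed.

(** For an ideal [P] this is PN; [setT] gives N itself. *)
Definition ideal_span (P : set S) : set A := combinations (@tofrac S @` P) B.

Definition stabilizer : set A :=
  [set a | forall n, ideal_span setT n -> ideal_span setT (a * n)].

(** The colon ideal (PN : N) inside the multiplier ring, that is, I_P. *)
Definition transporter (P : set S) : set A :=
  [set a | stabilizer a /\ forall n, ideal_span setT n -> ideal_span P (a * n)].

(** Two sets [P] and [P'] allow both for scaling within N and for sending N into PN by an element of
    P. *)
Lemma ideal_spanZ (P P' : set S) s n : (forall p, P p -> P' (s * p)) ->
  ideal_span P n -> ideal_span P' (tofrac s *: n).
Proof.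
move=> PP'; apply: combinationsZ => _ [p Pp <-].
by exists (s * p); [exact: PP' | rewrite rmorphM].
Qed.

Lemma ideal_spanS (P P' : set S) : P `<=` P' -> ideal_span P `<=` ideal_span P'.
Proof. by move=> PP'; apply: combinations_subset => // _ [p Pp <-]; exists p => //; exact: PP'. Qed.

Lemma ideal_span_basis b : B b -> ideal_span setT b.
Proof. by apply: combinations_gen; exists 1; rewrite ?rmorph1. Qed.

Lemma stabilizer_basis a :
  (forall b, B b -> ideal_span setT (a * b)) -> stabilizer a.
Proof.
move=> aB _ [n [c [b [Lc Bb ->]]]]; rewrite mulr_sumr; apply: combinations_sum => i.
have [s _ <-] := Lc i; rewrite -scalerAr; exact: ideal_spanZ (aB _ (Bb i)).
Qed.

Lemma subring_stabilizer : subring_closed [in stabilizer].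
Proof.
split; first by apply/mem_set => n; rewrite mul1r.
- move=> x y /set_mem Rx /set_mem Ry; apply/mem_set => n Nn.
  rewrite mulrBl; apply: combinationsD; first exact: Rx.
  by rewrite -scaleN1r -(rmorphN1 (@tofrac S)); apply: ideal_spanZ (Ry _ Nn).
- move=> x y /set_mem Rx /set_mem Ry; apply/mem_set => n Nn.
  by rewrite -mulrA; apply/Rx/Ry.
Qed.

Lemma stabilizerZ s x : stabilizer x -> stabilizer (tofrac s *: x).
Proof. by move=> Rx n /Rx Nxn; rewrite -scalerAl; apply: ideal_spanZ Nxn. Qed.

Lemma stabilizer_embS s : stabilizer (embS A s).
Proof. by apply: stabilizerZ => n; rewrite mul1r. Qed.

Let additive_tofrac (P : set S) : P 0 -> (forall x y, P x -> P y -> P (x + y)) ->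
  (@tofrac S @` P) 0 /\ (forall x y, (@tofrac S @` P) x -> (@tofrac S @` P) y -> (@tofrac S @` P) (x + y)).
Proof.
move=> P0 PD; split; first by exists 0; rewrite ?rmorph0.
by move=> _ _ [x Px <-] [y Py <-]; exists (x + y); [exact: PD | rewrite rmorphD].
Qed.

Lemma ideal_span_scalar (P : set S) f b : P 0 -> (forall x y, P x -> P y -> P (x + y)) ->
  B b -> ideal_span P (f *: b) -> (@tofrac S @` P) f.
Proof.
move=> P0 PD Bb; have [L0 LD] := additive_tofrac P0 PD.
exact: combinations_basis_coef.
Qed.

Lemma nice_stabilizer : nice_subalgebra stabilizer.
Proof.
have [b Bb] : exists b, B b.
  by apply: basis_nonempty => //; exists 1; apply/eqP; exact: oner_neq0.
split; first by split; [exact: subring_stabilizer | exact: stabilizerZ].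
- apply/seteqP; split=> [x [Rx [f _ fx]]|_ [s _ <-]]; last first.
    by split; [exact: stabilizer_embS | exists (tofrac s)].
  (* Acting on a basis vector [b], the scalar [f] gives [f *: b] in N, and freeness of N puts [f] in
     S. *)
  have := Rx _ (ideal_span_basis Bb); rewrite -fx -scalerAl mul1r.
  by case/(ideal_span_scalar (P := setT) I (fun _ _ _ _ => I) Bb) => s _ <-; exists s.
(* The basis [C] witnessing stability lies in the stabilizer and already spans [A]. *)
- apply/seteqP; split=> // a _; have [_ [C [[_ spanC] CB]]] := stableB.
  have : combinations setT C a by rewrite spanC.
  apply: combinations_subset => // c Cc; apply: stabilizer_basis => b' Bb'.
  exact: CB.
Qed.

Lemma transporter_saturated_over (P : set S) : is_prime_ideal [set: S] P ->
  saturated_over (R := stabilizer) (in_alg A \o @tofrac S) P (transporter P).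
Proof.
move=> primeP; have idP := prime_ideal_ideal primeP.
have [b Bb] : exists b, B b.
  by apply: basis_nonempty => //; exists 1; apply/eqP; exact: oner_neq0.
have P0 := ideal_zero idP; have PD := @ideal_add _ _ _ idP.
have [L0 LD] := additive_tofrac P0 PD.
have [LT0 LTD] := @additive_tofrac setT I (fun _ _ _ _ => I).
have [_ _ RM] := subring_stabilizer.
split; first split.
- by move=> x [].
- by split=> n _; rewrite mul0r; exact: combinations0.
- move=> x y [Rx Px] [Ry Py]; split=> n Nn; rewrite mulrDl.
    by apply: combinationsD; [exact: Rx | exact: Ry].
  by apply: combinationsD; [exact: Px | exact: Py].
- move=> a x Ra [Rx Px]; split; first by apply/set_mem/RM; exact/mem_set.
  (* By commutativity [a * x * n] is [x * (a * n)], and [a * n] is again in N. *)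
  by move=> n Nn; rewrite mulrAC mulrC; apply/Px/Ra.
- apply/seteqP; split=> s /=.
    (* If [s] sends [b] into PN, the coefficient at [b] shows that [s] is in [P]. *)
    case=> _ /(_ b (ideal_span_basis Bb)); rewrite -scalerAl mul1r.
    by case/(ideal_span_scalar P0 PD Bb) => p Pp /tofracI <-.
  move=> Ps; split; first exact: stabilizer_embS.
  move=> n Nn; rewrite -scalerAl mul1r; apply: ideal_spanZ Nn => t _.
  by rewrite mulrC; apply: (ideal_absorb idP).
- move=> t x nPt Rx [_ Ptx]; split=> // n Nn.
  (* Torsion-freeness of N / PN over S / P, read off coefficientwise: [t * s] in [P] with [t]
     outside [P] forces [s] in [P]. *)
  apply: (@combinations_saturated _ _ (@tofrac S @` setT) (@tofrac S @` P) B (tofrac t)) => //.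
  + move=> _ [s _ <-] [p Pp]; rewrite -rmorphM => /tofracI E.
    exists s => //; rewrite E in Pp.
    by case: (prime_ideal_prime primeP _ _ Pp).
  + exact: Rx.
  + by have := Ptx n Nn; rewrite /= -!scalerAl mul1r.
Qed.

Lemma transporterS (P P' : set S) : P `<=` P' -> transporter P `<=` transporter P'.
Proof. by move=> PP' x [Rx Px]; split=> // n /Px; exact: ideal_spanS. Qed.

End Stabilizer.

(** * Lifting the given chain to the stabilizer *)

Theorem mainTheorem5 (S : idomainType) (S_not_field : ~ GRing.field_axiom S)
    (A : comAlgType {fraction S})
    (A_neq_F : range (fun f : {fraction S} => f%:A : A) <> [set: A])
    (A_stable : exists B : set A, stable_basis B)
    (C : set (set S)) (C_chain : prime_chain [set: S] C) :
  exists R : set A, nice_subalgebra R /\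
    exists D : set (set A), prime_chain R D /\ covers D C.
Proof.
have [B stableB] := A_stable; exists (@stabilizer S A B).
split; first exact: nice_stabilizer.
(* The composite [in_alg A \o @tofrac S] is convertible to [embS], so the lifted chain covers [C] in
   the required sense. *)
apply: (lift_prime_chain (subring_stabilizer (B := B)) (f := in_alg A \o @tofrac S)
  _ (I := transporter (B := B)) C_chain).
- exact: stabilizer_embS.
- by move=> P /(proj1 C_chain); exact: transporter_saturated_over.
- by move=> P P' _ _; exact: transporterS.
Qed.
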